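(* Let $A\in\mathbb R^{n\times n}$ be row-stochastic with $1$ a simple eigenvalue and all other eigenvalues strictly inside the unit circle. Let $\mathbb P_0\in\mathcal P(\mathbb R^n)$, $\varepsilon\ge0$, $\mathbb Q_0\in\mathbb B_\varepsilon^{\|\cdot\|_2^2}(\mathbb P_0)$, and consider $x_{t+1}=Ax_t$ with $x_0\sim\mathbb Q_0$. Let $\mathbb Q_t$ be the distribution of $x_t$, and $\mathbb Q_\infty$ the distribution of $x_\infty:=\lim_{t\to\infty}x_t$. Let $w\in\mathbb R^n$ be the left eigenvector of $A$ associated with the eigenvalue $1$, normalized so that $\mathbb 1_n^\top w=1$. Then $$\mathbb Q_t\to\mathbb Q_\infty\in(\mathbb 1_n)_{\#}\,\mathbb B_{\varepsilon\|w\|_2^2}^{|\cdot|^2}\big((w^\top)_{\#}\mathbb P_0\big),$$ where $\to$ denotes weak convergence of probability distributions. If additionally $A$ is doubly-stochastic, then $w=\frac1n\mathbb 1_n$ and $$\mathbb Q_t\to\mathbb Q_\infty\in(\mathbb 1_n)_{\#}\,\mathbb B_{\varepsilon/n}^{|\cdot|^2}\big((\tfrac1n\mathbb 1_n^\top)_{\#}\mathbb P_0\big).$$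
   Context: $\mathbb 1_n\in\mathbb R^n$ is the all-ones vector. $\mathcal P(\mathbb R^k)$ is the set of Borel probability distributions on $\mathbb R^k$. Matrices and vectors are identified with linear maps: $(w^\top)_{\#}$ is pushforward under $x\mapsto w^\top x$ ($\mathbb R^n\to\mathbb R$) and $(\mathbb 1_n)_{\#}$ is pushforward under $s\mapsto s\,\mathbb 1_n$ ($\mathbb R\to\mathbb R^n$); the pushforward of a set of distributions is the set of pushforwards. For a cost $c:\mathbb R^k\to\mathbb R_{\ge0}$, $W_c(\mathbb P,\mathbb Q)=\inf_{\gamma\in\Gamma(\mathbb P,\mathbb Q)}\int c(x_1-x_2)\,d\gamma(x_1,x_2)$ with $\Gamma(\mathbb P,\mathbb Q)$ the set of couplings, and $\mathbb B_\varepsilon^c(\mathbb P)=\{\mathbb Q\in\mathcal P(\mathbb R^k):W_c(\mathbb P,\mathbb Q)\le\varepsilon\}$. The costs $\|\cdot\|_2^2$ on $\mathbb R^n$ and $|\cdot|^2$ on $\mathbb R$ are the squared Euclidean norm and squared absolute value. *)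

(* Defs.v *)
From HB Require Import structures.
From mathcomp Require Import all_boot all_order all_algebra.
From mathcomp Require Import all_classical all_reals all_analysis.
From mathcomp Require Import measurable_realfun giry.
From mathcomp Require Import complex.
Set Implicit Arguments.
Unset Strict Implicit.
Unset Printing Implicit Defensive.
Import Order.TTheory GRing.Theory Num.Theory.
Import numFieldNormedType.Exports.
Local Open Scope classical_set_scope.
Local Open Scope ring_scope.

(* Real matrices, in particular the column vectors 'cV[R]_n standing for R^n,
   carry the Borel sigma-algebra of their topology (that of the entrywise sup
   norm, which is the Euclidean one). *)
HB.instance Definition _ (R : realType) (m n : nat) :=
  @isMeasurable.Build (sigma_display (@open 'M[R]_(m, n))) 'M[R]_(m, n)
    <<s @open 'M[R]_(m, n) >> (@sigma_algebra0 _ setT _)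
    (@sigma_algebraC _ _) (@sigma_algebra_bigcup _ setT _).

Section spectrum.
Context {R : realType} {n : nat}.
Implicit Type A : 'M[R]_n.

Definition row_stochastic A : Prop :=
  (forall i j, 0 <= A i j) /\ (forall i, \sum_j A i j = 1).

Definition doubly_stochastic A : Prop :=
  row_stochastic A /\ (forall j, \sum_i A i j = 1).

Definition complexify A : 'M[R[i]]_n := map_mx (real_complex R) A.

(* Simplicity is algebraic: the multiplicity is that of the root of the
   characteristic polynomial. *)
Definition simple_eigenvalue A (z : R[i]) : Prop :=
  mup z (char_poly (complexify A)) = 1%N.

Definition left_eigenvector A (a : R) (w : 'cV[R]_n) : Prop :=
  w != 0 /\ w^T *m A = a *: w^T.

End spectrum.

Definition norm2 {R : realType} {n : nat} (x : 'cV[R]_n) : R :=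
  Num.sqrt (\sum_i `|x i 0| ^+ 2).

Definition ones {R : realType} (n : nat) : 'cV[R]_n := const_mx 1.

Section linear_maps.
Context {R : realType} {n : nat}.

Definition dot (w x : 'cV[R]_n) : R := (w^T *m x) 0 0.

Definition spread (s : R) : 'cV[R]_n := s *: ones n.

Lemma continuous_dot w : continuous (dot w).
Proof.
have -> : dot w = fun x => \sum_i w i 0 * x i 0.
  by apply/funext => x; rewrite /dot mxE; apply: eq_bigr => i _; rewrite mxE.
move=> x.
apply: (@cvg_big R 'I_n +%R 0 xpredT _ _ (nbhs x)) => [y|i _].
  exact: add_continuous.
by apply: cvgM; [exact: cvg_cst|exact: coord_continuous].
Qed.

Lemma continuous_spread : continuous spread.
Proof.
move=> s; apply/cvg_mx_entourageP => E entE.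
apply: filterS (nbhs_entourage s entE) => t /xsectionP sEt i j.
by rewrite !mxE !mulr1 inE.
Qed.

Lemma measurable_dot w : measurable_fun setT (dot w).
Proof.
apply: (measurability _ (RGenOpens.measurableE R)) => _ [_ [a [b ->]] <-].
rewrite setTI; apply: sub_sigma_algebra.
by move/continuousP: (@continuous_dot w); apply; exact: interval_open.
Qed.

Lemma measurable_spread : measurable_fun setT spread.
Proof.
apply: (measurability (@open 'cV[R]_n) erefl) => // _ [B oB <-].
rewrite setTI; apply: open_measurable.
by move/continuousP: continuous_spread; apply.
Qed.

HB.instance Definition _ w :=
  isMeasurableFun.Build _ _ _ _ (dot w) (measurable_dot w).
HB.instance Definition _ :=
  isMeasurableFun.Build _ _ _ _ spread measurable_spread.

End linear_maps.

Section transport.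
Context {R : realType} {d} {T : measurableType d}.
Implicit Types P Q : probability T R.

(* Measures are set functions on all subsets, so only their values on
   measurable sets are compared. T * T carries the product sigma-algebra; for
   T = R^k this is the Borel sigma-algebra of R^k x R^k. *)
Definition couplings P Q : set (probability (T * T)%type R) :=
  [set g | forall B, measurable B ->
     pushforward g fst B = P B /\ pushforward g snd B = Q B].

Definition transport_cost (c : T -> T -> R) P Q : \bar R :=
  ereal_inf [set (\int[g]_x (c x.1 x.2)%:E)%E | g in couplings P Q].

Definition transport_ball (c : T -> T -> R) (eps : R) P :
    set (probability T R) :=
  [set Q | (transport_cost c P Q <= eps%:E)%E].

End transport.

(* The cost of a displacement, as a two-point cost for transport_ball. *)
Definition diff_cost {R : realType} {V : zmodType} (c : V -> R) (x y : V) : R :=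
  c (x - y).

Definition pushforward_set {R : realType} {d d'} {T : measurableType d}
    {U : measurableType d'} (f : {mfun T >-> U}) (B : set (probability T R)) :
    set (probability U R) :=
  [set Q | exists2 P, B P & Q ≡μ distribution P f].

Definition weak_cvg {R : realType} {n : nat}
    (Q : nat -> probability 'cV[R]_n R) (Qlim : probability 'cV[R]_n R) : Prop :=
  forall f : 'cV[R]_n -> R, continuous f -> (exists M, forall x, `|f x| <= M) ->
    (\int[Q t]_x (f x)%:E)%E @[t --> \oo] --> (\int[Qlim]_x (f x)%:E)%E.

(* Main.v *)
From HB Require Import structures.
Require Import Defs.
From mathcomp Require Import all_boot all_order all_algebra.
From mathcomp Require Import all_classical all_reals all_analysis.
From mathcomp Require Import measurable_realfun giry complex ring lra.
Import Order.TTheory GRing.Theory Num.Theory.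
Import numFieldNormedType.Exports.
Import Normc.
Local Open Scope classical_set_scope.
Local Open Scope ring_scope.
Set Implicit Arguments.
Unset Strict Implicit.
Unset Printing Implicit Defensive.

(** Deflating [A] by its Perron pair, [M := A - ones *m w^T], keeps the dynamics
on the hyperplane orthogonal to [w] and kills the direction [ones]. Writing
[L := (w^T x_0) ones] for the component of [x_0] on the fixed line, one gets
[x_t = L + M^t (x_0 - L)], so everything rests on [M^t] going to 0.

The eigenvalues of [M] are read off from
[X^n char_poly A = char_poly M * char_poly (ones *m w^T)]
([char_poly_deflation]). The rank-one projection [ones *m w^T] already
contributes one factor [X - 1] to the right-hand side, and algebraic simplicity
allows only one on the left, so 1 is not an eigenvalue of [M]; every other
nonzero eigenvalue of [M] is one of [A] ([eigenvalue_deflation]). Hence the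
spectrum of [M] lies in the open unit disc, and Cayley-Hamilton together with
scalar contractions gives [M^t -> 0] ([cvg0_expmx]) and the consensus
[x_t -> (w^T x_0) ones] from every initial state ([cvg_consensus]).

The probabilistic part is then soft. Pointwise convergence of the random
vectors yields weak convergence of their laws by dominated convergence
([weak_cvg_pointwise]), and the limit law is the pushforward of [Q_0] under
[dot w] followed by [spread]. Pushing a coupling of [P_0] and [Q_0] forward by
[dot w] on both factors multiplies its quadratic cost by at most [norm2 w ^+ 2],
by Cauchy-Schwarz, which places the law of [w^T x_0] in the ball of radius
[eps * norm2 w ^+ 2] ([transport_ball_dot]).

In the doubly stochastic case the sum of the coordinates is conserved along the
orbits; comparing it at time 0 and in the limit, for the basis vectors as
initial states, forces [w i = 1 / n] ([doubly_stochastic_weight]), whence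
[norm2 w ^+ 2 = 1 / n]. *)

(** * Powers of a matrix with spectrum in the open unit disc *)

(** Unrolling the inequality from a time [N] after which the perturbation is at
most [(1 - rho) e / 2] gives [a (N + k) <= rho ^+ k * a N + e / 2], since
[e / 2] is the fixed point of [y |-> rho * y + (1 - rho) e / 2]. *)
Lemma cvg0_contraction (R : realType) (rho : R) (a b : R^nat) :
  0 <= rho < 1 -> (forall t, 0 <= a t) ->
  (forall t, a t.+1 <= rho * a t + b t) ->
  b @ \oo --> 0 -> a @ \oo --> 0.
Proof.
move=> /andP[rho0 rho1] a0 ab b0; apply/cvgr0Pnorm_le => e e0.
have rho1' : 0 < 1 - rho by rewrite subr_gt0.
have e2 : 0 < e / 2 by rewrite divr_gt0.
have [N _ bN] : \forall t \near \oo, `|b t| <= (e / 2) * (1 - rho).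
  by move/cvgr0Pnorm_le : b0; apply; rewrite mulr_gt0.
have aN k : a (N + k)%N <= rho ^+ k * a N + e / 2.
  elim: k => [|k IH]; first by rewrite addn0 expr0 mul1r lerDl ltW.
  rewrite addnS; apply: (le_trans (ab _)).
  have : b (N + k)%N <= (e / 2) * (1 - rho).
    by apply: (le_trans (ler_norm _)); apply: bN; rewrite /= leq_addr.
  have : rho * a (N + k)%N <= rho * (rho ^+ k * a N + e / 2).
    by rewrite ler_wpM2l.
  by rewrite exprS; lra.
have [K _ rK] : \forall k \near \oo, `|a N * rho ^+ k| <= e / 2.
  have : (fun k => a N * rho ^+ k) @ \oo --> (0 : R).
    rewrite -[X in _ --> X](mulr0 (a N)).
    by apply: cvgMr; apply: cvg_expr; rewrite ger0_norm.
  by move/cvgr0Pnorm_le; apply.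
exists (N + K)%N => // t /= NKt.
have Nt : (N <= t)%N by apply: leq_trans NKt; rewrite leq_addr.
have Kt : (K <= t - N)%N by rewrite leq_subRL.
rewrite ger0_norm // -(subnKC Nt).
have := rK _ Kt; have := aN (t - N)%N.
move=> h1 /(le_trans (ler_norm _)) h2.
by apply: (le_trans h1); lra.
Qed.

Lemma cvg0_normc_recurrence (R : realType) (z : R[i]) (u : nat -> R[i]) :
  normc z < 1 -> (fun t => normc (u t.+1 - z * u t)) @ \oo --> 0 ->
  (fun t => normc (u t)) @ \oo --> 0.
Proof.
have normc_ge0 (y : R[i]) : 0 <= normc y by case: y => p q; exact: sqrtr_ge0.
move=> z1; apply: (@cvg0_contraction R (normc z)) => // [|t].
  by rewrite normc_ge0.
rewrite -normcM -[X in normc X](subrK (z * u t)) addrC.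
exact: le_normcD.
Qed.

(** By Cayley-Hamilton, the product of the factors [M - z], over the roots [z] of
the characteristic polynomial, is 0. The factors can be peeled off one at a
time: if [M ^+ t * ((M - z) * C)] tends to 0, then each entry [u] of
[M ^+ t * C] satisfies [u t.+1 - z * u t -> 0], a scalar contraction. This
avoids Jordan forms and matrix norms. *)
Lemma cvg0_expmx (R : realType) (n : nat) (M : 'M[R[i]]_n) :
  (forall z, eigenvalue M z -> `|z| < 1) ->
  forall i j, (fun t => normc ((M ^+ t) i j)) @ \oo --> 0.
Proof.
case: n M => [M _ [] //|n M Mlt1].
pose N (s : seq R[i]) := horner_mx M (\prod_(z <- s) ('X - z%:P)).
have peel (s : seq R[i]) (B : 'M[R[i]]_n.+1) : (forall z, z \in s -> normc z < 1) ->
    (forall i j, (fun t => normc ((M ^+ t * (N s * B)) i j)) @ \oo --> 0) ->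
    forall i j, (fun t => normc ((M ^+ t * B) i j)) @ \oo --> 0.
  elim: s => [|z s IH] slt1 cvgN.
    by move: cvgN; rewrite /N big_nil rmorph1 mul1r.
  apply: IH => [y ys|i j]; first by apply: slt1; rewrite inE ys orbT.
  apply: (@cvg0_normc_recurrence _ z); first by apply: slt1; rewrite inE eqxx.
  suff -> : (fun t => normc ((M ^+ t.+1 * (N s * B)) i j -
                             z * (M ^+ t * (N s * B)) i j)) =
            (fun t => normc ((M ^+ t * (N (z :: s) * B)) i j)) by [].
  apply/funext => t; congr normc.
  rewrite /N big_cons rmorphM rmorphB /= horner_mx_X horner_mx_C -/(N s).
  rewrite -(mulrA _ (N s)) (mulrA (M ^+ t) (M - _)) mulrBr -exprSr mulrBl [RHS]mxE.
  congr (_ + _).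
  by rewrite [RHS]mxE -scalemx1 -scalerAr mulr1 -scalerAl [in RHS]mxE.
have [s chM] := closed_field_poly_normal (char_poly M).
rewrite (monicP (char_poly_monic M)) scale1r in chM.
move=> i j.
have -> : (fun t => normc ((M ^+ t) i j)) = (fun t => normc ((M ^+ t * 1) i j)).
  by apply/funext => t; rewrite mulr1.
apply: (peel s) => [z zs|{}i {}j].
  have : eigenvalue M z by rewrite eigenvalue_root_char chM root_prod_XsubC.
  move/Mlt1; case: (z) => p q; rewrite normc_def -(rmorph1 (real_complex R)).
  by rewrite ltcR.
rewrite /N -chM Cayley_Hamilton.
under eq_fun do rewrite mul0r mulr0 mxE normc0.
exact: cvg_cst.
Qed.

(** * Deflation of the eigenvalue 1 *)

(** As [c] is fixed by [A] and [c *m r] is a projection, the cross terms cancel in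
[(X - (A - c *m r)) * (X - c *m r) = X * (X - A)]; take determinants. *)
Lemma char_poly_deflation (F : fieldType) (n : nat) (A : 'M[F]_n)
    (c : 'cV[F]_n) (r : 'rV[F]_n) :
  A *m c = c -> r *m c = 1%:M ->
  'X^n * char_poly A = char_poly (A - c *m r) * char_poly (c *m r).
Proof.
move=> Ac rc.
have -> : 'X^n = \det ('X%:M : 'M[{poly F}]_n) by rewrite det_scalar.
rewrite /char_poly -!det_mulmx; congr (\det _).
rewrite /char_poly_mx !map_mxB map_mxM /=.
set A' := map_mx _ A; set c' := map_mx _ c; set r' := map_mx _ r.
have Ac' : A' *m c' = c' by rewrite /A' /c' -map_mxM Ac.
have rc' : r' *m c' = 1%:M by rewrite /r' /c' -map_mxM rc map_mx1.
rewrite !(mulmxBr, mulmxBl) !mulmxA Ac' -(mulmxA c' r' c') rc' mulmx1.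
rewrite !mul_mx_scalar !mul_scalar_mx -?scalemxAl.
rewrite subrr subr0 opprB.
by rewrite addrA [RHS]addrAC addrK.
Qed.

(** Compares the two sides of [char_poly_deflation]: the multiplicities of the root
1 exclude [z = 1], and evaluation at [z] makes any other nonzero [z] a root of
[char_poly A]. *)
Lemma eigenvalue_deflation (F : fieldType) (n : nat) (A : 'M[F]_n)
    (c : 'cV[F]_n) (r : 'rV[F]_n) (z : F) :
  A *m c = c -> r *m c = 1%:M -> mup 1 (char_poly A) = 1%N ->
  eigenvalue (A - c *m r) z -> z = 0 \/ (z != 1 /\ eigenvalue A z).
Proof.
move=> Ac rc simple1 zM; have [->|z0] := eqVneq z 0; [by left|right].
have chE := char_poly_deflation Ac rc.
have nz (B : 'M[F]_n) : char_poly B != 0 := monic_neq0 (char_poly_monic B).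
have Mz : root (char_poly (A - c *m r)) z by rewrite -eigenvalue_root_char.
split.
  apply/eqP => z1; have := congr1 (mup 1) chE.
  rewrite !mupM ?nz ?monic_neq0 ?monicXn // simple1.
  have -> : mup 1 ('X^n : {poly F}) = 0%N.
    by rewrite mupNroot // rootE hornerXn expr1n oner_eq0.
  (* Both right-hand factors would vanish at 1, giving multiplicity at least 2
     against 1 on the left. *)
  have mup_gt0 (p : {poly F}) : p != 0 -> root p 1 -> (0 < mup 1 p)%N.
    by move=> p0; rewrite -XsubC_dvd // dvdp_XsubCl.
  have M_gt0 : (0 < mup 1 (char_poly (A - c *m r)))%N by rewrite mup_gt0 // -z1.
  have cr_gt0 : (0 < mup 1 (char_poly (c *m r)))%N.
    rewrite mup_gt0 // -eigenvalue_root_char; apply/eigenvalueP.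
    exists r; first by rewrite mulmxA rc mul1mx scale1r.
    apply/eqP => r0; move/eqP: rc; rewrite r0 mul0mx eq_sym.
    by rewrite -scalemx1 scaler_eq0 oner_eq0 (negPf (matrix_nonzero1 _ 0)).
  by move=> e; have := leq_add M_gt0 cr_gt0; rewrite -e.
have /eqP := congr1 (horner^~ z) chE.
rewrite eigenvalue_root_char /root !hornerM (rootP Mz) mul0r hornerXn.
by rewrite mulf_eq0 expf_eq0 (negPf z0) andbF.
Qed.

(** * Consensus *)

Lemma cvg_mx_entrywise (R : realType) (m n : nat) (T : Type)
    (F : set_system T) (FF : Filter F) (v : T -> 'M[R]_(m, n)) (L : 'M[R]_(m, n)) :
  (forall i j, v t i j @[t --> F] --> L i j) -> v t @[t --> F] --> L.
Proof.
move=> vL; apply/cvg_mx_entourageP => E entE.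
apply: filter_forall => i; apply: filter_forall => j.
exact: (vL i j (xsection E (L i j)) (nbhs_entourage _ entE)).
Qed.

Lemma cvg_consensus (R : realType) (n : nat) (A : 'M[R]_n) (w : 'cV[R]_n)
    (v : nat -> 'cV[R]_n) :
  row_stochastic A -> simple_eigenvalue A 1 ->
  (forall z : R[i], eigenvalue (complexify A) z -> z != 1 -> `|z| < 1) ->
  left_eigenvector A 1 w -> (ones n)^T *m w = 1%:M ->
  (forall t, v t.+1 = A *m v t) ->
  v t @[t --> \oo] --> spread (dot w (v 0%N)).
Proof.
move=> [_ A1] simple1 Alt1 [_ wA] w1 vS.
rewrite scale1r in wA.
have Ac : A *m ones n = ones n.
  apply/matrixP => i j; rewrite !mxE -[RHS](A1 i).
  by apply: eq_bigr => k _; rewrite mxE mulr1.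
have wc : w^T *m ones n = 1%:M by rewrite -[LHS]trmxK trmx_mul trmxK w1 trmx1.
pose M := A - ones n *m w^T.
have cM : complexify M = complexify A -
    map_mx (real_complex R) (ones n) *m map_mx (real_complex R) w^T.
  by rewrite /complexify map_mxB map_mxM.
have Mlt1 z : eigenvalue (complexify M) z -> `|z| < 1.
  rewrite cM => /eigenvalue_deflation [] //.
  - by rewrite -map_mxM Ac.
  - by rewrite -map_mxM wc map_mx1.
  - by move=> ->; rewrite normr0 ltr01.
  - by move=> [z1 /Alt1]; apply.
have Mt0 i j : (fun t => (M ^+ t) i j) @ \oo --> (0 : R).
  apply: norm_cvg0; have := cvg0_expmx Mlt1 i j.
  suff -> : (fun t => normc ((complexify M ^+ t) i j)) =
            (fun t => `|(M ^+ t) i j|) by [].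
  apply/funext => t; rewrite /complexify -rmorphXn mxE /=.
  by rewrite expr0n addr0 sqrtr_sqr.
pose L := spread (dot w (v 0%N)) : 'cV[R]_n.
have dotv t : w^T *m v t = w^T *m v 0%N.
  by elim: t => // t IH; rewrite vS mulmxA wA.
have LE : ones n *m (w^T *m v 0%N) = L.
  by rewrite [X in _ *m X]mx11_scalar mul_mx_scalar.
(* [L] is fixed by [A], and on [v t - L], which is orthogonal to [w], the
   matrices [A] and [M] agree. *)
have vE t : v t = L + M ^+ t *m (v 0%N - L).
  elim: t => [|t IH]; first by rewrite expr0 mul1mx addrC subrK.
  rewrite vS exprS -mulmxA.
  have -> : M ^+ t *m (v 0%N - L) = v t - L by rewrite IH addrAC subrr add0r.
  rewrite /M mulmxBl -mulmxA mulmxBr (mulmxBr w^T) dotv -LE !mulmxA Ac wc mul1mx.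
  by rewrite subrr mulmx0 subr0 addrC subrK.
apply: cvg_mx_entrywise => i j.
have E0 : (fun t => \sum_k (M ^+ t) i k * (v 0%N - L) k j) @ \oo --> (0 : R).
  have : (fun t => \sum_k (M ^+ t) i k * (v 0%N - L) k j) @ \oo -->
      \sum_(k < n) 0 * (v 0%N - L) k j.
    apply: (@cvg_big R 'I_n +%R 0 xpredT) => [y|k _].
      exact: add_continuous.
    by apply: cvgM; [exact: Mt0|exact: cvg_cst].
  by rewrite big1 // => k _; rewrite mul0r.
have -> : (fun t => v t i j) =
    (fun t => L i j + \sum_k (M ^+ t) i k * (v 0%N - L) k j).
  by apply/funext => t; rewrite vE mxE [X in _ + X]mxE.
by have := cvgD (cvg_cst (L i j)) E0; rewrite addr0; apply.
Qed.

(** * Weak convergence from pointwise convergence *)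

Lemma continuous_measurable_cV (R : realType) (n : nat) (f : 'cV[R]_n -> R) :
  continuous f -> measurable_fun setT f.
Proof.
move=> fc; apply: (measurability _ (RGenOpens.measurableE R)).
move=> _ [_ [a [b ->]] <-]; rewrite setTI; apply: sub_sigma_algebra.
by move/continuousP: fc; apply; exact: interval_open.
Qed.

(** Test functions are bounded, so their integrals, transported to [Omega],
converge by dominated convergence with a constant bound. *)
Lemma weak_cvg_pointwise (R : realType) (n : nat) (d : measure_display)
    (Omega : measurableType d) (P : probability Omega R)
    (x : nat -> {mfun Omega >-> 'cV[R]_n}) (y : {mfun Omega >-> 'cV[R]_n}) :
  (forall om, x t om @[t --> \oo] --> y om) ->
  weak_cvg (fun t => distribution P (x t)) (distribution P y).
Proof.
move=> xy f fc [M fM].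
have mf := continuous_measurable_cV fc.
have mfz (z : {mfun Omega >-> 'cV[R]_n}) :
    measurable_fun setT (fun om => (f (z om))%:E).
  by apply/measurable_EFinP; exact: measurableT_comp.
have intM : P.-integrable setT (fun _ => M%:E).
  exact: finite_measure_integrable_cst.
have intE (z : {mfun Omega >-> 'cV[R]_n}) :
    (\int[distribution P z]_v (f v)%:E = \int[P]_om (f (z om))%:E)%E.
  apply: integral_distribution; first exact/measurable_EFinP.
  apply: (le_integrable _ _ _ intM) => //; first exact: mfz.
  by move=> om _ /=; rewrite lee_fin (le_trans (fM _)) // ler_norm.
under eq_fun do rewrite intE.
rewrite intE.
apply: (@dominated_cvg _ _ _ P setT measurableT _ _ (fun _ => M%:E)) => //.
- move=> om _; apply: cvg_EFin; first exact: nearW.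
  by apply: continuous_cvg; [exact: fc|exact: xy].
- by move=> t om _ /=; rewrite lee_fin.
Qed.

(** * Transport balls under linear functionals *)

Lemma dotE (R : realType) (n : nat) (w z : 'cV[R]_n) :
  dot w z = \sum_i w i 0 * z i 0.
Proof. by rewrite /dot mxE; apply: eq_bigr => i _; rewrite mxE. Qed.

Lemma dotB (R : realType) (n : nat) (w y z : 'cV[R]_n) :
  dot w (y - z) = dot w y - dot w z.
Proof. by rewrite /dot mulmxBr !mxE. Qed.

Lemma norm2_sqr (R : realType) (n : nat) (z : 'cV[R]_n) :
  norm2 z ^+ 2 = \sum_i z i 0 ^+ 2.
Proof.
rewrite sqr_sqrtr; last by apply: sumr_ge0 => i _; rewrite sqr_ge0.
by apply: eq_bigr => i _; rewrite real_normK ?num_real.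
Qed.

Lemma norm2_sqr_gt0 (R : realType) (n : nat) (z : 'cV[R]_n) :
  z != 0 -> 0 < norm2 z ^+ 2.
Proof.
move=> z0; rewrite lt_neqAle sqr_ge0 andbT eq_sym; apply: contra z0.
rewrite norm2_sqr psumr_eq0 => [/allP z0|i _]; last exact: sqr_ge0.
apply/eqP/matrixP => i j; rewrite (ord1 j) mxE.
by have := z0 i (mem_index_enum i); rewrite /= sqrf_eq0 => /eqP.
Qed.

(** Cauchy-Schwarz, from the nonnegativity of the squared norm of
[norm2 w ^+ 2 *: z - dot w z *: w]. *)
Lemma dot_sqr_le (R : realType) (n : nat) (w z : 'cV[R]_n) :
  dot w z ^+ 2 <= norm2 w ^+ 2 * norm2 z ^+ 2.
Proof.
have [->|/norm2_sqr_gt0] := eqVneq w 0.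
  rewrite dotE big1 => [|i _]; last by rewrite mxE mul0r.
  by rewrite expr0n /= mulr_ge0 ?sqr_ge0.
set s := norm2 w ^+ 2; set q := norm2 z ^+ 2; set p := dot w z => s_gt0.
have : 0 <= \sum_i (s * z i 0 - p * w i 0) ^+ 2.
  by apply: sumr_ge0 => i _; exact: sqr_ge0.
have -> : \sum_i (s * z i 0 - p * w i 0) ^+ 2 = s * (s * q - p ^+ 2).
  transitivity (s ^+ 2 * (\sum_i z i 0 ^+ 2) -
      2 * s * p * (\sum_i w i 0 * z i 0) + p ^+ 2 * (\sum_i w i 0 ^+ 2)).
    rewrite !mulr_sumr -sumrB -big_split /=.
    by apply: eq_bigr => i _; ring.
  by rewrite -!norm2_sqr -dotE -/s -/q -/p; ring.
by rewrite pmulr_rge0 // subr_ge0.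
Qed.

(** The bound on the costs of the pushed couplings passes to the infimum after
division by [norm2 w ^+ 2], which needs [w != 0]: for [w = 0] an infinite
transport cost would be multiplied by 0. *)
Lemma transport_ball_dot (R : realType) (n : nat) (w : 'cV[R]_n) (eps : R)
    (P Q : probability 'cV[R]_n R) :
  let c1 := diff_cost (fun s : R => `|s| ^+ 2) in
  let c2 := diff_cost (fun y : 'cV[R]_n => norm2 y ^+ 2) in
  w != 0 -> transport_ball c2 eps P Q ->
  transport_ball c1 (eps * norm2 w ^+ 2)
    (distribution P (dot w)) (distribution Q (dot w)).
Proof.
move=> c1 c2 w0; rewrite /transport_ball /= => PQ.
have := norm2_sqr_gt0 w0; move sE : (norm2 w ^+ 2) => s s_gt0.
pose pr (z : 'cV[R]_n * 'cV[R]_n) : R * R := (dot w z.1, dot w z.2).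
have mpr : measurable_fun setT pr.
  apply/measurable_fun_pairP; split.
    exact: (measurableT_comp (measurable_dot w) measurable_fst).
  exact: (measurableT_comp (measurable_dot w) measurable_snd).
pose prm : {mfun ('cV[R]_n * 'cV[R]_n)%type >-> (R * R)%type} :=
  HB.pack pr (isMeasurableFun.Build _ _ _ _ pr mpr).
have mcost2 : measurable_fun setT
    (fun x : 'cV[R]_n * 'cV[R]_n => norm2 (x.1 - x.2) ^+ 2).
  under eq_fun do rewrite norm2_sqr.
  apply: measurable_sum => i; apply: measurable_funX.
  under eq_fun do rewrite !mxE.
  have mi : measurable_fun setT (fun z : 'cV[R]_n => z i 0).
    by apply: continuous_measurable_cV; exact: coord_continuous.
  by apply: measurable_funB; exact: measurableT_comp mi _.
have mcost1 : measurable_fun setT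
    (fun x : R * R => `|x.1 - x.2| ^+ 2).
  apply: measurable_funX; apply: measurableT_comp => //.
  exact: measurable_funB.
suff le_cost : (transport_cost c1 (distribution P (dot w))
      (distribution Q (dot w)) <= s%:E * transport_cost c2 P Q)%E.
  apply: (le_trans le_cost); rewrite (mulrC eps) EFinM.
  by rewrite lee_pmul2l ?lte_fin.
rewrite -lee_pdivrMl //; apply: le_ereal_inf_tmp => _ [g gPQ <-].
rewrite lee_pdivrMl //.
apply: ge_ereal_inf; exists (\int[distribution g prm]_x (c1 x.1 x.2)%:E)%E.
  exists (distribution g prm) => // B mB.
  apply: (gPQ (dot w @^-1` B)).
  by rewrite -[X in measurable X]setTI; exact: measurable_dot.
rewrite ge0_integral_pushforward //; [|exact/measurable_EFinP|].
  rewrite preimage_setT -ge0_integralZl //; first last.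
  - by rewrite lee_fin ltW.
  - by move=> z _; rewrite lee_fin sqr_ge0.
  - exact/measurable_EFinP.
  apply: ge0_le_integral => //.
  - by move=> z _; rewrite lee_fin sqr_ge0.
  - by apply: (measurableT_comp _ (mpr)); exact/measurable_EFinP.
  - by apply/measurable_EFinP; exact: measurable_funM.
  - move=> z _ /=; rewrite -EFinM lee_fin /c1 /c2 /diff_cost -sE -dotB real_normK ?num_real //.
    exact: dot_sqr_le.
by move=> z _; rewrite lee_fin sqr_ge0.
Qed.

(** * The doubly stochastic case and the conclusion *)

(** Starting from the basis vector [delta_mx i 0], the sum of the coordinates stays
equal to 1, while that of the limit [spread (w i 0)] is [n * w i 0]. *)
Lemma doubly_stochastic_weight (R : realType) (n : nat) (A : 'M[R]_n)
    (w : 'cV[R]_n) :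
  doubly_stochastic A -> simple_eigenvalue A 1 ->
  (forall z : R[i], eigenvalue (complexify A) z -> z != 1 -> `|z| < 1) ->
  left_eigenvector A 1 w -> (ones n)^T *m w = 1%:M ->
  w = n%:R^-1 *: ones n.
Proof.
move=> [Arow Acol] simple1 Alt1 wA w1; apply/matrixP => i j.
rewrite (ord1 j) !mxE mulr1.
have n0 : n%:R != 0 :> R by rewrite pnatr_eq0 -lt0n (leq_trans _ (ltn_ord i)).
pose v t : 'cV[R]_n := A ^+ t *m delta_mx i 0.
have vS t : v t.+1 = A *m v t by rewrite /v exprS -mulmxA.
have sumA : (ones n)^T *m A = (ones n)^T :> 'rV[R]_n.
  apply/matrixP => k l; rewrite !mxE -[RHS](Acol l).
  by apply: eq_bigr => m _; rewrite !mxE mul1r.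
have dot_delta (u : 'cV[R]_n) : dot u (delta_mx i 0) = u i 0.
  rewrite dotE (bigD1 i) //= mxE !eqxx mulr1 big1 ?addr0 // => k ki.
  by rewrite mxE (negPf ki) mulr0.
have sum_v t : dot (ones n) (v t) = 1.
  elim: t => [|t IH].
    by rewrite /v expr0 mul1mx dot_delta mxE.
  by rewrite vS /dot mulmxA sumA.
have : dot (ones n) (v t) @[t --> \oo] --> dot (ones n) (spread (dot w (v 0%N))).
  apply: continuous_cvg; first exact: continuous_dot.
  exact: cvg_consensus vS.
under eq_fun do rewrite sum_v.
have -> : dot (ones n) (spread (dot w (v 0%N))) = w i 0 * n%:R.
  rewrite /v expr0 mul1mx dot_delta dotE.
  under eq_bigr do rewrite !mxE mul1r mulr1.
  by rewrite sumr_const card_ord mulr_natr.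
move=> lim1; have e := @cvg_unique R (@norm_hausdorff _ R) _ _ _ _ (cvg_cst (1 : R)) lim1.
by apply: (mulIf n0); rewrite mulVf //; apply: esym; exact: e.
Qed.

Theorem proposition20 (R : realType) (n : nat) (A : 'M[R]_n)
    (P0 Q0 : probability 'cV[R]_n R) (eps : R) (w : 'cV[R]_n)
    (d : measure_display) (Omega : measurableType d) (P : probability Omega R)
    (x : nat -> {mfun Omega >-> 'cV[R]_n}) :
  row_stochastic A ->
  simple_eigenvalue A 1 ->
  (forall z : R[i], eigenvalue (complexify A) z -> z != 1 -> `|z| < 1) ->
  0 <= eps ->
  transport_ball (diff_cost (fun y : 'cV[R]_n => norm2 y ^+ 2)) eps P0 Q0 ->
  distribution P (x 0%N) ≡μ Q0 ->
  (forall t om, x t.+1 om = A *m x t om) ->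
  left_eigenvector A 1 w ->
  (ones n)^T *m w = 1%:M ->
  exists xlim : {mfun Omega >-> 'cV[R]_n},
    [/\ forall om, x t om @[t --> \oo] --> xlim om,
        weak_cvg (fun t => distribution P (x t)) (distribution P xlim),
        pushforward_set spread
          (transport_ball (diff_cost (fun s : R => `|s| ^+ 2))
             (eps * norm2 w ^+ 2) (distribution P0 (dot w)))
          (distribution P xlim)
      & doubly_stochastic A ->
        [/\ w = n%:R^-1 *: ones n,
            weak_cvg (fun t => distribution P (x t)) (distribution P xlim)
          & pushforward_set spread
              (transport_ball (diff_cost (fun s : R => `|s| ^+ 2))
                 (eps / n%:R) (distribution P0 (dot (n%:R^-1 *: ones n))))
              (distribution P xlim)]].
Proof.
move=> Arow simple1 Alt1 eps0 PQ x0Q xS wA w1.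
pose xlim : {mfun Omega >-> 'cV[R]_n} := spread \o (dot w \o x 0%N).
have xcvg om : x t om @[t --> \oo] --> xlim om.
  by apply: (cvg_consensus (v := fun t => x t om)) wA w1 _ => // t; exact: xS.
have weak := weak_cvg_pointwise (P := P) xcvg.
have w0 : w != 0 by case: wA.
have ball : pushforward_set spread
    (transport_ball (diff_cost (fun s : R => `|s| ^+ 2))
       (eps * norm2 w ^+ 2) (distribution P0 (dot w))) (distribution P xlim).
  exists (distribution Q0 (dot w)); first exact: transport_ball_dot.
  move=> S mS; apply: (x0Q (dot w @^-1` (spread @^-1` S))).
  rewrite -[X in measurable X]setTI; apply: measurable_dot => //.
  by rewrite -[X in measurable X]setTI; exact: measurable_spread.
exists xlim; split=> // Adouble.
have wE := doubly_stochastic_weight Adouble simple1 Alt1 wA w1.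
split=> //.
have normw : norm2 w ^+ 2 = n%:R^-1.
  rewrite norm2_sqr wE; under eq_bigr do rewrite !mxE mulr1.
  rewrite sumr_const card_ord -[_ *+ n]mulr_natr expr2 -mulrA mulVf ?mulr1 //.
  by apply: contra w0 => /eqP n0; rewrite wE n0 invr0 scale0r.
by rewrite -wE -normw.
Qed.
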